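(* Let $\mathcal{A}=(A,[\cdot,\dots,\cdot],\alpha)$ be an $(n+1)$-dimensional $n$-Hom-Lie algebra. If $\dim\ker\alpha\ge2$, then $\mathcal{A}$ is multiplicative if and only if $[\alpha]B=0$, where $[\alpha]$ and $B$ are the matrices representing the twisting map $\alpha$ and the bracket, respectively, in any given basis of $A$.
   Context: All linear spaces are over a field $\mathbb{K}$ of characteristic $0$, and $n\ge2$. An $n$-Hom-Lie algebra $(A,[\cdot,\dots,\cdot],\alpha)$ is a linear space $A$ with a skew-symmetric $n$-linear bracket and a linear map $\alpha:A\to A$ (the twisting map) such that for all $x_i,y_j\in A$ $$[\alpha(x_1),\dots,\alpha(x_{n-1}),[y_1,\dots,y_n]]=\sum_{i=1}^n[\alpha(y_1),\dots,\alpha(y_{i-1}),[x_1,\dots,x_{n-1},y_i],\alpha(y_{i+1}),\dots,\alpha(y_n)].$$ It is multiplicative if $\alpha([x_1,\dots,x_n])=[\alpha(x_1),\dots,\alpha(x_n)]$ for all $x_1,\dots,x_n\in A$. For $\dim A=n+1$ and a basis $(e_i)_{1\le i\le n+1}$ of $A$, the matrix $B=(b(i,j))_{1\le i,j\le n+1}$ representing the bracket is defined by $$[e_1,\dots,\widehat{e_i},\dots,e_{n+1}]=(-1)^{n+1+i}w_i,\qquad w_i=\sum_{p=1}^{n+1}b(p,i)e_p,$$ where $\widehat{e_i}$ means that $e_i$ is omitted; $[\alpha]$ is the matrix of $\alpha$ in the same basis (columns are the coordinates of the $\alpha(e_i)$). *)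

(* Defs.v *)
From HB Require Import structures.
From mathcomp Require Export all_boot all_order all_algebra all_fingroup.

Set Implicit Arguments.
Unset Strict Implicit.
Unset Printing Implicit Defensive.

Export GRing.Theory.
#[global] Open Scope ring_scope.

Section Arguments.
Variables (T : Type) (n : nat).

(* (y_1, .., y_(i-1), v, y_(i+1), .., y_n) *)
Definition replace_arg (y : {ffun 'I_n -> T}) (i : 'I_n) (v : T) :
    {ffun 'I_n -> T} :=
  [ffun j => if j == i then v else y j].

(* (x_1, .., x_(n-1), v): insub (val i) is Some i when i < n.-1, and None
   when i is the last index. *)
Definition rcons_arg (x : {ffun 'I_n.-1 -> T}) (v : T) : {ffun 'I_n -> T} :=
  [ffun i : 'I_n => oapp x v (insub (val i))].

End Arguments.

Definition map_arg (T U : Type) (n : nat) (f : T -> U) (x : {ffun 'I_n -> T}) :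
    {ffun 'I_n -> U} :=
  [ffun i => f (x i)].

Definition multilinear (K : fieldType) (A : vectType K) (n : nat)
    (br : {ffun 'I_n -> A} -> A) : Prop :=
  forall (x : {ffun 'I_n -> A}) (i : 'I_n) (c : K) (u v : A),
    br (replace_arg x i (c *: u + v)) =
      c *: br (replace_arg x i u) + br (replace_arg x i v).

Definition skew_symmetric (K : fieldType) (A : vectType K) (n : nat)
    (br : {ffun 'I_n -> A} -> A) : Prop :=
  forall (s : 'S_n) (x : {ffun 'I_n -> A}),
    br [ffun i => x (s i)] = (-1) ^+ s *: br x.

Definition hom_nambu (K : fieldType) (A : vectType K) (n : nat)
    (br : {ffun 'I_n -> A} -> A) (alpha : 'End(A)) : Prop :=
  forall (x : {ffun 'I_n.-1 -> A}) (y : {ffun 'I_n -> A}),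
    br (rcons_arg (map_arg alpha x) (br y)) =
      \sum_(i < n)
        br (replace_arg (map_arg alpha y) i (br (rcons_arg x (y i)))).

Record nHomLie (K : fieldType) (n : nat) (A : vectType K) := NHomLie {
  bracket : {ffun 'I_n -> A} -> A;
  twist : 'End(A);
  bracket_multilinear : multilinear bracket;
  bracket_skew : skew_symmetric bracket;
  bracket_hom_nambu : hom_nambu bracket twist
}.

Section Matrices.
Variables (K : fieldType) (n : nat) (A : vectType K) (L : nHomLie n A).

Definition is_multiplicative : Prop :=
  forall x : {ffun 'I_n -> A},
    twist L (bracket L x) = bracket L (map_arg (twist L) x).

Variable e : n.+1.-tuple A.

Definition bracket_omit (i : 'I_n.+1) : A :=
  bracket L [ffun j : 'I_n => e`_(lift i j)].

(* Indices start at 0 here, so the sign (-1)^(n+1+i) of the 1-based convention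
   becomes (-1)^(n+1+(i+1)); it is its own inverse. *)
Definition bracket_w (i : 'I_n.+1) : A :=
  (-1) ^+ (n.+1 + i.+1) *: bracket_omit i.

Definition bracket_mx : 'M[K]_n.+1 := \matrix_(p, i) coord e p (bracket_w i).

Definition twist_mx : 'M[K]_n.+1 := \matrix_(p, i) coord e p (twist L e`_i).

Lemma bracket_mxP : basis_of fullv e -> forall i : 'I_n.+1,
  bracket_omit i =
    (-1) ^+ (n.+1 + i.+1) *: \sum_(p < n.+1) bracket_mx p i *: e`_p.
Proof.
move=> eB i; have -> : \sum_(p < n.+1) bracket_mx p i *: e`_p = bracket_w i.
  rewrite [RHS](coord_basis eB) ?memvf //.
  by apply: eq_bigr => p _; rewrite mxE.
by rewrite /bracket_w scalerA -exprD addnn -mul2n exprM sqrrN expr1n expr1n scale1r.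
Qed.

End Matrices.

(* Main.v *)
Require Import Defs.

Set Implicit Arguments.
Unset Strict Implicit.
Unset Printing Implicit Defensive.

(** The image of the twisting map has dimension at most n - 1, so an alternating
    n-linear bracket vanishes on it, and multiplicativity reduces to
    [alpha ([x_1, .., x_n]) = 0]. By multilinearity and skew-symmetry this needs
    only be checked on the w_i, whose images under alpha have the columns of
    [alpha]B as coordinates. *)

Section Multilinear.
Variables (K : fieldType) (A : vectType K) (n : nat).
Implicit Types (br : {ffun 'I_n -> A} -> A) (x : {ffun 'I_n -> A}).

Lemma replace_arg_id x i : replace_arg x i (x i) = x.
Proof. by apply/ffunP=> j; rewrite ffunE; case: eqP => [->|]. Qed.

(** This allows extension from a basis to be applied to the composite of [twist L] with the
    bracket. *)
Lemma multilinear_comp br (f : 'End(A)) :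
  multilinear br -> multilinear (fun x => f (br x)).
Proof. by move=> ml x i c u v; rewrite ml linearP. Qed.

Lemma multilinear_span_eq0 br (X : seq A) :
    multilinear br ->
    (forall x, (forall i, x i \in X) -> br x = 0) ->
  forall x, (forall i, x i \in <<X>>%VS) -> br x = 0.
Proof.
move=> ml brX0.
(* Induction on the number [k] of leading arguments ranging over the span. *)
suff IH k x : (forall i, x i \in <<X>>%VS) ->
    (forall i : 'I_n, (k <= i)%N -> x i \in X) -> br x = 0.
  by move=> x xX; apply: (IH n) => // i; rewrite leqNgt ltn_ord.
elim: k x => [|k IH] x xX xkX; first by apply: brX0 => i; apply: xkX.
have [le_nk|lt_kn] := leqP n k.
  by apply: IH => // i le_ki; have := ltn_ord i; rewrite ltnNge (leq_trans le_nk).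
pose i := Ordinal lt_kn.
rewrite -(replace_arg_id x i) (coord_span (X := in_tuple X) (xX i)).
(* Taking [c = -1] and [u = v = 0] expresses the value at 0 as [- b + b]. *)
have br0 : br (replace_arg x i 0) = 0.
  by have := ml x i (-1) 0 0; rewrite scaler0 addr0 scaleN1r addNr.
apply: (big_ind (fun v => br (replace_arg x i v) = 0)) => // [u v u0 v0|j _].
  by have := ml x i 1 u v; rewrite !scale1r u0 v0 addr0.
have Xj : X`_j \in X by apply: mem_nth.
have := ml x i (coord (in_tuple X) j (x i)) X`_j 0.
(* With argument [k] now equal to an element of [X], only the arguments before [k] still range over
   the span. *)
rewrite addr0 br0 addr0 => ->; rewrite IH ?scaler0 // => l.
  by rewrite ffunE; case: eqP => // _; apply: memv_span.
rewrite ffunE; case: eqP => // /eqP ne_li le_kl; apply: xkX.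
by rewrite ltn_neqAle le_kl andbT eq_sym.
Qed.

(** Transposing two equal arguments fixes [x] but changes the sign, so [2 * br x = 0]. *)
Lemma skew_symmetric_eq0 br x (i j : 'I_n) :
    2 \notin [pchar K] -> skew_symmetric br -> i != j -> x i = x j ->
  br x = 0.
Proof.
move=> char2 skew ne_ij xij.
have := skew (tperm i j) x; rewrite odd_tperm ne_ij expr1 scaleN1r.
have -> : [ffun k => x (tperm i j k)] = x.
  by apply/ffunP=> k; rewrite ffunE; case: tpermP => // ->.
move/eqP; rewrite -subr_eq0 opprK -mulr2n -scaler_nat scaler_eq0.
case/orP=> [two0|/eqP //]; case/negP: char2.
by rewrite inE /= two0.
Qed.

Lemma skew_symmetric_injective br x :
    2 \notin [pchar K] -> skew_symmetric br -> br x != 0 -> injective x.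
Proof.
move=> char2 skew brx i j xij; apply/eqP/negPn/negP=> ne_ij.
by case/eqP: brx; apply: skew_symmetric_eq0 xij.
Qed.

(** Pigeonhole: a basis of [U] has fewer than [n] vectors, so any [n] arguments taken from it repeat
    one and [br] vanishes there; multilinearity does the rest. *)
Lemma alternating_small_dim_eq0 br (U : {vspace A}) x :
    2 \notin [pchar K] -> multilinear br -> skew_symmetric br ->
    (\dim U < n)%N -> (forall i, x i \in U) ->
  br x = 0.
Proof.
move=> char2 ml skew dimU xU.
apply: (multilinear_span_eq0 (X := vbasis U) ml) => [y yU|i]; last first.
  by rewrite (span_basis (vbasisP U)).
apply/eqP/negPn/negP=> /(skew_symmetric_injective char2 skew) y_inj.
have : (size (codom y) <= size (vbasis U))%N.
  apply: uniq_leq_size; first exact/injectiveP.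
  by move=> _ /codomP[i ->].
by rewrite size_codom card_ord size_tuple leqNgt dimU.
Qed.

End Multilinear.

(** By counting, [f] misses some [i], so it factors through [lift i]; the remaining factor is an
    injective self-map of ['I_n], hence a permutation. *)
Lemma injective_lift_perm (n : nat) (f : 'I_n -> 'I_n.+1) :
  injective f -> exists (i : 'I_n.+1) (s : 'S_n), forall j, f j = lift i (s j).
Proof.
move=> f_inj.
have [i fi] : exists i, i \notin codom f.
  apply/existsP; rewrite -negb_forall; apply/negP=> /forallP f_onto.
  have : (#|'I_n.+1| <= #|codom f|)%N.
    by apply/subset_leq_card/subsetP=> i _; apply: f_onto.
  by rewrite card_codom // !card_ord ltnn.
have fP j : {k | f j = lift i k}.
  have /unlift_some[k fj _] : i != f j.
    by apply: contraNneq fi => ->; apply: codom_f.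
  by exists k.
have s_inj : injective (fun j => sval (fP j)).
  move=> j k /= eq_jk; apply: f_inj.
  by apply: etrans (svalP (fP j)) _; rewrite eq_jk -(svalP (fP k)).
by exists i, (perm s_inj) => j; rewrite permE -(svalP (fP j)).
Qed.

Section Bracket.
Variables (K : fieldType) (n : nat) (A : vectType K) (L : nHomLie n A).
Variable e : n.+1.-tuple A.
Hypothesis e_basis : basis_of {:A} e.

Lemma twist_bracket_mxE p i :
  (twist_mx L e *m bracket_mx L e) p i = coord e p (twist L (bracket_w L e i)).
Proof.
rewrite [bracket_w L e i](coord_basis e_basis) ?memvf // !linear_sum !mxE.
apply: eq_bigr => q _; rewrite !mxE; move: (bracket_w L e i) => w.
by rewrite !linearZ mulrC.
Qed.

(** Each [bracket_w] is [bracket_omit] up to a sign, and a vector is zero once its coordinates in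
    the basis are. *)
Lemma twist_bracket_mx_eq0 :
  twist_mx L e *m bracket_mx L e = 0 <->
  forall i, twist L (bracket_omit L e i) = 0.
Proof.
split=> [M0 i|tw0].
  have tw_w0 : twist L (bracket_w L e i) = 0.
    rewrite [LHS](coord_basis e_basis) ?memvf // big1 // => p _.
    by rewrite -twist_bracket_mxE M0 mxE scale0r.
  move/eqP: tw_w0; rewrite linearZ scaler_eq0 signr_eq0 => /eqP //.
apply/matrixP=> p i.
by rewrite twist_bracket_mxE linearZ /= tw0 scaler0 linear0 mxE.
Qed.

(** A nonzero bracket of basis vectors has distinct arguments, so these are all of [e] but one, in
    some order, and the bracket is some [bracket_omit] up to sign. *)
Lemma twist_bracket_eq0 :
    2 \notin [pchar K] -> (forall i, twist L (bracket_omit L e i) = 0) ->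
  forall x, twist L (bracket L x) = 0.
Proof.
move=> char2 tw0 x; have skew := bracket_skew L.
have ml := multilinear_comp (twist L) (bracket_multilinear L).
apply: (multilinear_span_eq0 (X := e) ml) => [y ye|i]; last first.
  by rewrite (span_basis e_basis) memvf.
have [->|/(skew_symmetric_injective char2 skew) y_inj] := eqVneq (bracket L y) 0.
  exact: linear0.
have yE j : {k : 'I_n.+1 | y j = e`_k}.
  have lt_j : (index (y j) e < n.+1)%N.
    by have := ye j; rewrite -index_mem size_tuple.
  by exists (Ordinal lt_j); rewrite /= nth_index.
have f_inj : injective (fun j => sval (yE j)).
  by move=> j k eq_jk; apply: y_inj; apply: etrans (svalP (yE j)) _; rewrite eq_jk -(svalP (yE k)).
have [i [s fE]] := injective_lift_perm f_inj.
have -> : y = [ffun j => [ffun k : 'I_n => e`_(lift i k)] (s j)].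
  by apply/ffunP=> j; rewrite !ffunE -fE -(svalP (yE j)).
by rewrite skew linearZ /= [twist L _]tw0 scaler0.
Qed.

End Bracket.

Theorem proposition9 (K : fieldType) (charK : [pchar K] =i pred0)
    (n : nat) (n_ge2 : (2 <= n)%N)
    (A : vectType K) (dimA : \dim {:A} = n.+1)
    (L : nHomLie n A) (dim_ker : (2 <= \dim (lker (twist L)))%N)
    (e : n.+1.-tuple A) (e_basis : basis_of {:A} e) :
  is_multiplicative L <-> twist_mx L e *m bracket_mx L e = 0.
Proof.
have char2 : 2 \notin [pchar K] by rewrite charK.
have dim_img : (\dim (limg (twist L)) < n)%N.
  have := limg_ker_dim (twist L) {:A}; rewrite capfv dimA => dimE.
  (* Rank-nullity turns the goal into [2 + dim(im) <= dim(ker) + dim(im)]. *)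
  by rewrite -ltnS -dimE; apply: (leq_add dim_ker (leqnn _)).
have br_img0 x : bracket L (map_arg (twist L) x) = 0.
  apply: (alternating_small_dim_eq0 char2 _ _ dim_img) => [||i].
  - exact: bracket_multilinear.
  - exact: bracket_skew.
  - by rewrite ffunE memv_img ?memvf.
split=> [mult|M0].
  by apply/(twist_bracket_mx_eq0 L e_basis)=> i; rewrite mult br_img0.
move=> x; rewrite br_img0; apply: (twist_bracket_eq0 e_basis char2).
exact/(twist_bracket_mx_eq0 L e_basis).
Qed.
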